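(* For every fixed integer $k\ge 1$, there are only finitely many (up to isomorphism) $k$-vertex-critical $(P_1+P_3)$-free graphs.
   Context: All graphs are finite and simple. $P_1+P_3$ is the disjoint union of a single vertex and a path on 3 vertices; a graph is $(P_1+P_3)$-free if it has no induced subgraph isomorphic to $P_1+P_3$. A graph $G$ is $k$-vertex-critical if $\chi(G)=k$ and $\chi(G-v)<k$ for every vertex $v$, where $\chi$ is the chromatic number. *)

(* Defs.v *)
From mathcomp Require Import all_boot.

Set Implicit Arguments.
Unset Strict Implicit.
Unset Printing Implicit Defensive.

Record sgraph := SGraph {
  vertex :> finType;
  adj : rel vertex;
  adj_sym : symmetric adj;
  adj_irrefl : irreflexive adj
}.

Definition isomorphic (G H : sgraph) : Prop :=
  exists f : G -> H, bijective f /\ forall x y, adj (f x) (f y) = adj x y.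

Section Induced.
Variables (G : sgraph) (S : {set G}).

Definition induced_adj : rel {x : G | x \in S} :=
  fun x y => adj (val x) (val y).

Lemma induced_sym : symmetric induced_adj.
Proof. by move=> x y; rewrite /induced_adj adj_sym. Qed.

Lemma induced_irrefl : irreflexive induced_adj.
Proof. by move=> x; rewrite /induced_adj adj_irrefl. Qed.

Definition induced : sgraph := SGraph induced_sym induced_irrefl.
End Induced.

Definition delete_vertex (G : sgraph) (v : G) : sgraph := induced [set~ v].

Section PathGraph.
Variable n : nat.

Definition path_adj : rel 'I_n := fun i j => (i.+1 == j) || (j.+1 == i).

Lemma path_adj_sym : symmetric path_adj.
Proof. by move=> i j; rewrite /path_adj orbC. Qed.

Lemma path_adj_irrefl : irreflexive path_adj.
Proof. by move=> i; rewrite /path_adj orbb gtn_eqF. Qed.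

Definition path_graph : sgraph := SGraph path_adj_sym path_adj_irrefl.
End PathGraph.

Section DisjointUnion.
Variables G H : sgraph.

Definition union_adj : rel (G + H)%type := fun u v =>
  match u, v with
  | inl x, inl y => adj x y
  | inr x, inr y => adj x y
  | _, _ => false
  end.

Lemma union_adj_sym : symmetric union_adj.
Proof. by move=> [x|x] [y|y] //=; rewrite adj_sym. Qed.

Lemma union_adj_irrefl : irreflexive union_adj.
Proof. by move=> [x|x] /=; rewrite adj_irrefl. Qed.

Definition disjoint_union : sgraph := SGraph union_adj_sym union_adj_irrefl.
End DisjointUnion.

Definition induced_free (H G : sgraph) : Prop :=
  ~ exists S : {set G}, isomorphic (induced S) H.

Definition P1_P3 : sgraph := disjoint_union (path_graph 1) (path_graph 3).

Definition colorable (G : sgraph) (k : nat) : bool :=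
  [exists c : {ffun G -> 'I_k}, forall x, forall y, adj x y ==> (c x != c y)].

Lemma colorable_ex (G : sgraph) : exists k, colorable G k.
Proof.
exists #|G|; apply/existsP; exists [ffun x => enum_rank x].
apply/forallP=> x; apply/forallP=> y; apply/implyP=> xy.
rewrite !ffunE (inj_eq enum_rank_inj); apply/eqP=> exy.
by rewrite exy adj_irrefl in xy.
Qed.

Definition chromatic_number (G : sgraph) : nat := ex_minn (colorable_ex G).

Definition vertex_critical (k : nat) (G : sgraph) : Prop :=
  chromatic_number G = k /\
  forall v : G, chromatic_number (delete_vertex v) < k.

(* Main.v *)
Require Import Defs.
From mathcomp Require Import all_boot.

(** A [k]-vertex-critical [(P1+P3)]-free graph has no independent set
    [{a, b, c}] of size three, so its [k] colour classes have at most two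
    vertices each and it has at most [2k] vertices.

    Suppose [{a, b, c}] is independent.  By [(P1+P3)]-freeness every vertex that
    sees two of [a, b, c] sees all three; hence [N(a)] splits into the private
    neighbours [A] of [a] and the set [D] of common neighbours of [a, b, c], and
    likewise for [N(b)] with private neighbours [B].  Moreover [B] is a clique,
    and every vertex of [D] is adjacent to every vertex of [B].  Say
    [#|A| <= #|B|].  In a proper colouring of [G - a] the clique [b |: B]
    receives [#|B| + 1] colours, so one of them does not occur on [A]; it does
    not occur on [D] either, so it can be given to [a], contradicting
    criticality. *)

(** * Induced copies of P1+P3 *)

Lemma isomorphic_sym (G H : sgraph) : isomorphic G H -> isomorphic H G.
Proof.
case=> f [[g fK gK] fE]; exists g; split; first by exists f.
by move=> x y; rewrite -fE !gK.
Qed.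

Lemma induced_image_isomorphic (G H : sgraph) (g : H -> G) :
    injective g -> (forall x y, adj (g x) (g y) = adj x y) ->
  isomorphic (induced (g @: [set: H])) H.
Proof.
move=> g_inj gE; apply: isomorphic_sym.
have gS x : g x \in g @: [set: H] by rewrite imset_f ?inE.
pose h x : induced (g @: [set: H]) := exist _ (g x) (gS x).
exists h; split=> [|x y]; last exact: gE.
(* The map [h] is injective and its codomain has as many vertices as [H]. *)
apply: inj_card_bij => [x y /(congr1 val) /g_inj //|].
by rewrite card_sig card_imset // cardsT.
Qed.

(** Otherwise [u] and the path [x], [y], [z] would induce a P1+P3. *)
Lemma P1_P3_free_adj (G : sgraph) (u x y z : G) :
    induced_free P1_P3 G ->
    adj x y -> adj y z -> ~~ adj x z -> x != z ->
    u \notin [:: x; y; z] -> adj u x || adj u y || adj u z.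
Proof.
move=> freeG xy yz xz neq_xz; rewrite !inE !negb_or => /and3P[ux uy uz].
apply: contraT => /norP[/norP[nux nuy] nuz]; case: freeG.
have neq_xy : x != y by apply: contraTneq xy => ->; rewrite adj_irrefl.
have neq_yz : y != z by apply: contraTneq yz => ->; rewrite adj_irrefl.
pose g (w : P1_P3) : G :=
  match w with inl _ => u | inr i => nth u [:: x; y; z] i end.
exists (g @: [set: P1_P3]); apply: induced_image_isomorphic.
- have uniq3 : uniq [:: u; x; y; z].
    by rewrite /= !inE !negb_or ux uy uz neq_xy neq_xz neq_yz.
  case=> [i|i] [j|j] //=.
  + by move=> _; rewrite (ord1 i) (ord1 j).
  (* Reading [u] as entry 0 and the path vertex [j] as entry [j.+1] of one duplicate-free list tells
     them apart. *)
  + move/eqP; rewrite -[u in u == _]/(nth u [:: u; x; y; z] 0).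
    by rewrite -[nth _ _ j]/(nth u [:: u; x; y; z] j.+1) nth_uniq //= ltnS.
  + move/eqP; rewrite -[u in _ == u]/(nth u [:: u; x; y; z] 0).
    by rewrite -[nth _ _ i]/(nth u [:: u; x; y; z] i.+1) nth_uniq //= ltnS.
  + move=> eq_ij; congr inr; apply: val_inj; apply/eqP.
    by move/eqP: eq_ij; case/andP: uniq3 => _ uniq3; rewrite nth_uniq.
- rewrite adj_sym in nux; rewrite adj_sym in nuy; rewrite adj_sym in nuz.
  case=> [i|[[|[|[|//]]] lt_i]] [j|[[|[|[|//]]] lt_j]] //=;
    rewrite ?(ord1 i) ?(ord1 j) ?adj_irrefl ?xy ?yz //;
    by [apply/negbTE | rewrite adj_sym ?xy ?yz //; apply/negbTE].
Qed.

(** * Colourings and vertex deletion *)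

Lemma colorableP (G : sgraph) (k : nat) :
  reflect (exists c : G -> 'I_k, forall x y, adj x y -> c x != c y)
          (colorable G k).
Proof.
apply: (iffP existsP) => [[c /forallP cP]|[c cP]].
  by exists c => x y; move/forallP: (cP x) => /(_ y) /implyP.
exists (finfun c); apply/forallP=> x; apply/forallP=> y.
by apply/implyP; rewrite !ffunE; apply: cP.
Qed.

Lemma chromatic_number_colorable (G : sgraph) :
  colorable G (chromatic_number G).
Proof. by rewrite /chromatic_number; case: ex_minnP. Qed.

Lemma chromatic_number_le (G : sgraph) (k : nat) :
  colorable G k -> chromatic_number G <= k.
Proof. by rewrite /chromatic_number; case: ex_minnP => m _ minm /minm. Qed.

(** The colouring of G - v is made total by giving [v] the colour of [w]. Without a second vertex,
    [k] could be 0 and no total map would exist. *)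
Lemma colorable_delete_vertexP (G : sgraph) (v w : G) (k : nat) :
    w != v -> colorable (delete_vertex v) k ->
  exists c : G -> 'I_k,
    forall x y, x != v -> y != v -> adj x y -> c x != c y.
Proof.
move=> wv /colorableP[c cP].
have in_del x : x != v -> x \in [set~ v] by rewrite !inE.
pose d x := c (insubd (exist _ w (in_del w wv) : delete_vertex v) x).
exists d => x y xv yv xy; apply: cP.
by rewrite /= /induced_adj !insubdK ?in_del.
Qed.

Lemma colorable_recolor (G : sgraph) (v : G) (k : nat) (c : G -> 'I_k)
    (i : 'I_k) :
    (forall x y, x != v -> y != v -> adj x y -> c x != c y) ->
    (forall x, adj v x -> c x != i) ->
  colorable G k.
Proof.
move=> cP iP; apply/colorableP; exists (fun x => if x == v then i else c x).
move=> x y; have [->|xv] := eqVneq x v; have [->|yv] := eqVneq y v.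
- by rewrite adj_irrefl.
- by move/iP; rewrite eq_sym.
- by rewrite adj_sym => /iP.
- exact: cP.
Qed.

(** * Independent triples *)

Definition private_nbrs (G : sgraph) (a b : G) : {set G} :=
  [set x | adj a x && ~~ adj b x].

(** Otherwise [c] misses the induced path [a], [x], [b]. *)
Lemma common_nbr_third (G : sgraph) (a b c x : G) :
    induced_free P1_P3 G -> a != b -> a != c -> b != c ->
    ~~ adj a b -> ~~ adj a c -> ~~ adj b c ->
  adj a x -> adj b x -> adj c x.
Proof.
move=> freeG neq_ab neq_ac neq_bc nab nac nbc.
move=> ax bx; rewrite adj_sym in bx.
have neq_cx : c != x by apply: contraNneq nac => ->.
have := @P1_P3_free_adj G c a x b freeG ax bx nab neq_ab.
rewrite !inE !negb_or neq_cx ![c == _]eq_sym neq_ac neq_bc => /(_ isT).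
by rewrite [adj c a]adj_sym [adj c b]adj_sym (negbTE nac) (negbTE nbc) orbF.
Qed.

Lemma independent_triple_extend (G : sgraph) (a b c : G) (k : nat) :
    induced_free P1_P3 G -> a != b -> a != c -> b != c ->
    ~~ adj a b -> ~~ adj a c -> ~~ adj b c ->
    #|private_nbrs G a b| <= #|private_nbrs G b a| ->
  colorable (delete_vertex a) k -> colorable G k.
Proof.
move=> freeG neq_ab neq_ac neq_bc nab nac nbc leAB.
have neq_ba : b != a by rewrite eq_sym.
have nba : ~~ adj b a by rewrite adj_sym.
case/(@colorable_delete_vertexP G a b k neq_ba) => col colP.
set A := private_nbrs G a b in leAB; set B := private_nbrs G b a in leAB.
have B_nc x : x \in B -> ~~ adj c x.
  rewrite inE => /andP[bx nax]; apply: contra nax => cx.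
  by apply: (@common_nbr_third G b c a x) => //; rewrite 1?eq_sym // adj_sym.
have B_neq_a x : x \in B -> x != a.
  by rewrite inE => /andP[bx _]; apply: contraTneq bx => ->.
have B_neq_c x : x \in B -> x != c.
  by rewrite inE => /andP[bx _]; apply: contraTneq bx => ->.
(* If [x] and [y] were not adjacent, [a] would miss the induced path [x], [b], [y]. *)
have B_clique x y : x \in B -> y \in B -> x != y -> adj x y.
  move=> xB yB neq_xy; apply: contraT => nxy.
  move: (xB) (yB); rewrite !inE => /andP[bx nax] /andP[yb nay].
  rewrite adj_sym in bx.
  have := @P1_P3_free_adj G a x b y freeG bx yb nxy neq_xy.
  rewrite !inE !negb_or neq_ab ![a == _]eq_sym !B_neq_a // => /(_ isT).
  by rewrite (negbTE nax) (negbTE nab) (negbTE nay).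
(* The path [a], [d], [c] is induced, and [x] sees neither of its ends. *)
have D_B d x : adj a d -> adj b d -> x \in B -> adj x d.
  move=> ad bd xB.
  have cd : adj c d by apply: (@common_nbr_third G a b c d).
  rewrite adj_sym in cd.
  have := @P1_P3_free_adj G x a d c freeG ad cd nac neq_ac.
  have neq_xd : x != d.
    by apply: contraTneq xB => ->; rewrite inE ad andbF.
  rewrite !inE !negb_or B_neq_a // B_neq_c // neq_xd => /(_ isT).
  rewrite [adj x c]adj_sym (negbTE (B_nc x xB)) orbF.
  by move: xB; rewrite inE adj_sym [adj a x]adj_sym => /andP[_ /negbTE->].
have bNB : b \notin B by rewrite inE adj_irrefl.
have col_inj : {in b |: B &, injective col}.
  move=> x y xC yC /eqP eq_xy; apply/eqP; apply: contraLR eq_xy => neq_xy.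
  have C_neq_a z : z \in b |: B -> z != a.
    by rewrite in_setU1 => /orP[/eqP->|/B_neq_a].
  apply: colP; rewrite ?C_neq_a //.
  move: xC yC neq_xy; rewrite !in_setU1.
  case/orP=> [/eqP->|xB]; case/orP=> [/eqP->|yB]; rewrite ?eqxx //.
  - by move: yB; rewrite inE => /andP[].
  - by move: xB; rewrite inE adj_sym => /andP[].
  - exact: B_clique.
(* Pigeonhole: the clique uses [#|B| + 1] colours, while [A] uses at most [#|A| <= #|B|]. *)
have /subsetPn[i /imsetP[z zC ->] iA] : ~~ (col @: (b |: B) \subset col @: A).
  apply/negP => /subset_leq_card; rewrite card_in_imset // cardsU1 bNB.
  apply/negP; rewrite -ltnNge ltnS.
  exact: leq_trans (leq_imset_card _ _) leAB.
apply: (@colorable_recolor G a k col (col z)) => // x ax.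
(* A neighbour of [a] that misses [b] lies in [A], whose colours avoid [col z]; one that sees [b] is
   adjacent to [z] itself. *)
have [bx|nbx] := boolP (adj b x); last first.
  by apply: contraNneq iA => <-; rewrite imset_f // inE ax.
apply: colP.
- by apply: contraTneq ax => ->; rewrite adj_irrefl.
- by move: zC; rewrite in_setU1 => /orP[/eqP->|/B_neq_a].
- rewrite adj_sym; move: zC; rewrite in_setU1 => /orP[/eqP-> //|zB].
  exact: D_B.
Qed.

Lemma vertex_critical_no_independent_triple (k : nat) (G : sgraph) (a b c : G) :
    vertex_critical k G -> induced_free P1_P3 G ->
    a != b -> a != c -> b != c ->
  adj a b || adj a c || adj b c.
Proof.
move=> [chiG critG] freeG neq_ab neq_ac neq_bc.
apply: contraT => /norP[/norP[nab nac] nbc].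
have no_ext (v : G) : ~ colorable G (chromatic_number (delete_vertex v)).
  by move/chromatic_number_le; rewrite chiG leqNgt critG.
(* By symmetry, delete whichever of [a] and [b] has at most as many private neighbours as the
   other. *)
case/orP: (leq_total #|private_nbrs G a b| #|private_nbrs G b a|) => leAB.
- case: (no_ext a); apply: (@independent_triple_extend G a b c) => //.
  exact: chromatic_number_colorable.
- case: (no_ext b); apply: (@independent_triple_extend G b a c) => //.
  + by rewrite eq_sym.
  + by rewrite adj_sym.
  + exact: chromatic_number_colorable.
Qed.

Lemma vertex_critical_P1_P3_free_card (k : nat) (G : sgraph) :
  vertex_critical k G -> induced_free P1_P3 G -> #|G| <= k * 2.
Proof.
move=> critG freeG; have [chiG _] := critG.
have /colorableP[c cP] := chromatic_number_colorable G; rewrite chiG in c cP.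
rewrite -sum1_card (partition_big c predT) //=.
rewrite -[k in k * 2]card_ord -sum_nat_const; apply: leq_sum => i _.
rewrite sum1_card leqNgt; apply/negP => /card_gt2P[x [y [z []]]].
case=> /eqP/val_inj xi /eqP/val_inj yi /eqP/val_inj zi [xy yz zx].
rewrite eq_sym in zx.
have nadj u v : c u = i -> c v = i -> ~~ adj u v.
  by move=> ui vi; apply/negP => /cP; rewrite ui vi eqxx.
have := @vertex_critical_no_independent_triple k G x y z critG freeG xy zx yz.
by rewrite (negbTE (nadj x y xi yi)) (negbTE (nadj x z xi zi))
  (negbTE (nadj y z yi zi)).
Qed.

(** * Finiteness up to isomorphism *)

Section FunctionGraph.
Variables (n : nat) (f : {ffun 'I_n * 'I_n -> bool}).

(** Symmetrising and clearing the diagonal makes every boolean function encode a graph, so that a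
    finite type indexes all graphs on [n] vertices. *)
Definition ffun_adj : rel 'I_n :=
  fun x y => (x != y) && (f (x, y) || f (y, x)).

Lemma ffun_adj_sym : symmetric ffun_adj.
Proof. by move=> x y; rewrite /ffun_adj eq_sym orbC. Qed.

Lemma ffun_adj_irrefl : irreflexive ffun_adj.
Proof. by move=> x; rewrite /ffun_adj eqxx. Qed.

Definition ffun_graph : sgraph := SGraph ffun_adj_sym ffun_adj_irrefl.
End FunctionGraph.

Lemma isomorphic_ffun_graph (G : sgraph) :
  exists f : {ffun 'I_#|G| * 'I_#|G| -> bool}, isomorphic G (ffun_graph #|G| f).
Proof.
exists [ffun p => adj (enum_val p.1 : G) (enum_val p.2)].
exists (fun x => enum_rank x : ffun_graph _ _); split.
  by exists enum_val; [exact: enum_rankK | exact: enum_valK].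
move=> x y; rewrite /= /ffun_adj !ffunE /= !enum_rankK.
rewrite (inj_eq enum_rank_inj) [adj y x]adj_sym orbb.
by have [->|//] := eqVneq; rewrite adj_irrefl.
Qed.

Lemma finitely_many_graphs_of_bounded_card (N : nat) :
  exists (n : nat) (F : 'I_n -> sgraph),
    forall G : sgraph, #|G| <= N -> exists i : 'I_n, isomorphic G (F i).
Proof.
pose E (m : 'I_N.+1) : finType := {ffun 'I_m * 'I_m -> bool}.
(* Codes pair an order [m <= N] with a function; isomorphic graphs may have several codes, which is
   harmless. *)
pose T : finType := {m : 'I_N.+1 & E m}.
exists #|T|, (fun i => ffun_graph _ (tagged (enum_val i : T))) => G leGN.
have [f isoGf] := isomorphic_ffun_graph G.
pose t : T := existT E (Ordinal (leGN : #|G| < N.+1)) f.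
by exists (enum_rank t); rewrite enum_rankK.
Qed.

Theorem theorem15 (k : nat) (k_ge1 : 1 <= k) :
  exists (n : nat) (F : 'I_n -> sgraph),
    forall G : sgraph,
      vertex_critical k G -> induced_free P1_P3 G ->
      exists i : 'I_n, isomorphic G (F i).
Proof.
have [n [F FP]] := finitely_many_graphs_of_bounded_card (k * 2).
exists n, F => G critG freeG.
exact/FP/vertex_critical_P1_P3_free_card.
Qed.
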